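(* Let $\Gamma$ be an $R$-thin connected graph and $k \ge 1$ an integer. If $2k+1$ is compatible with $\Gamma$, then $(\Gamma, C_{2k+1})$ is stable.
   Context: All graphs are finite and undirected with no loops or parallel edges. $V(\Gamma)$, $E(\Gamma)$ are the vertex and edge sets, $N_\Gamma(u)$ is the neighbourhood of $u$, $\deg(u)=|N_\Gamma(u)|$, $\mathrm{Aut}(\Gamma)$ is the automorphism group, and $C_n$ is the cycle with $n\ge 3$ vertices. The direct product $\Gamma \times \Sigma$ has vertex set $V(\Gamma) \times V(\Sigma)$, with $(u,v)$ and $(x,y)$ adjacent if and only if $\{u,x\}\in E(\Gamma)$ and $\{v,y\}\in E(\Sigma)$. A graph $\Gamma$ is $R$-thin if $N_\Gamma(u) \ne N_\Gamma(v)$ for any two distinct vertices $u,v$. A graph pair $(\Gamma,\Sigma)$ is stable if $\mathrm{Aut}(\Gamma)\times\mathrm{Aut}(\Sigma)$ is isomorphic to $\mathrm{Aut}(\Gamma\times\Sigma)$. $\Gamma^*$ is the graph with vertex set $V(\Gamma)$ in which $u,v$ are adjacent if and only if $u \ne v$ and $\deg(u)=\deg(v)=2|N_\Gamma(u)\cap N_\Gamma(v)|$ (degrees in $\Gamma$). For $u\in V(\Gamma)$: if $u$ is isolated in $\Gamma^*$, $L(u)=\{0\}$; if $u$ has degree $1$ in $\Gamma^*$, $L(u)=\{0,1\}$; if $u$ has degree at least $2$ in $\Gamma^*$, $L(u)$ is the (possibly empty) set of lengths of the cycles of $\Gamma^*$ containing $u$. An integer $n\ge3$ is compatible with $\Gamma$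 if either (i) $n$ is odd and $n\notin L(u)$ for at least one $u\in V(\Gamma)$, or (ii) $n$ is even and $n/2\notin L(u)$ for at least one $u\in V(\Gamma)$.
   Formalization: The formal theorem also assumes that Γ has at least two vertices; for Γ = K_1 the claim fails for k ≥ 2, since K_1 × C_{2k+1} has no edges and its automorphism group is the full symmetric group. *)

(* Defs.v *)
From mathcomp Require Import all_boot all_fingroup.

Set Implicit Arguments.
Unset Strict Implicit.
Unset Printing Implicit Defensive.

Record sgraph := SGraph {
  vertex :> finType;
  adj : rel vertex;
  adj_sym : symmetric adj;
  adj_irrefl : irreflexive adj
}.
Arguments adj {G} : rename.

Definition nbhd (G : sgraph) (u : G) : {set G} := [set v | adj u v].

Definition deg (G : sgraph) (u : G) : nat := #|nbhd u|.

Definition connected (G : sgraph) : Prop := forall u v : G, connect adj u v.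

Definition rthin (G : sgraph) : Prop :=
  forall u v : G, u != v -> nbhd u != nbhd v.

Definition cycle_adj (n : nat) : rel 'I_n :=
  [rel i j | (i != j) && ((ordS i == j) || (ordS j == i))].

Lemma cycle_adj_sym n : symmetric (@cycle_adj n).
Proof. by move=> i j; rewrite /cycle_adj /= [i == j]eq_sym orbC. Qed.

Lemma cycle_adj_irrefl n : irreflexive (@cycle_adj n).
Proof. by move=> i; rewrite /cycle_adj /= eqxx. Qed.

(* The vertices are the residues modulo n; this is the n-cycle for n >= 3. *)
Definition cycle_graph (n : nat) : sgraph :=
  SGraph (@cycle_adj_sym n) (@cycle_adj_irrefl n).

Section DirectProduct.
Variables G H : sgraph.

Definition direct_adj : rel (G * H)%type :=
  [rel p q | adj p.1 q.1 && adj p.2 q.2].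

Lemma direct_adj_sym : symmetric direct_adj.
Proof. by move=> p q; rewrite /direct_adj /= adj_sym [adj p.2 _]adj_sym. Qed.

Lemma direct_adj_irrefl : irreflexive direct_adj.
Proof. by move=> p; rewrite /direct_adj /= adj_irrefl. Qed.

Definition direct_product : sgraph := SGraph direct_adj_sym direct_adj_irrefl.
End DirectProduct.

Section Automorphisms.
Variable G : sgraph.

Definition graph_aut : {set {perm G}} :=
  [set s : {perm G} | [forall u, forall v, adj (s u) (s v) == adj u v]].

Lemma graph_aut_group_set : group_set graph_aut.
Proof.
apply/group_setP; split=> [|s t].
  by rewrite inE; apply/'forall_'forall_eqP => u v; rewrite !perm1.
rewrite !inE => /'forall_'forall_eqP hs /'forall_'forall_eqP ht.
by apply/'forall_'forall_eqP => u v; rewrite !permM ht hs.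
Qed.

Canonical graph_aut_group : {group {perm G}} := Group graph_aut_group_set.
End Automorphisms.

(* setX is the external direct product of the two automorphism groups. *)
Definition stable (G H : sgraph) : bool :=
  setX (graph_aut G) (graph_aut H) \isog graph_aut (direct_product G H).

Section Star.
Variable G : sgraph.

Definition star_adj : rel G :=
  [rel u v | [&& u != v, deg u == deg v
               & deg v == 2 * #|nbhd u :&: nbhd v|]].

Lemma star_adj_sym : symmetric star_adj.
Proof.
move=> u v; rewrite /star_adj /= [u == v]eq_sym [deg u == deg v]eq_sym setIC.
by case: (eqVneq (deg v) (deg u)) => [->|].
Qed.

Lemma star_adj_irrefl : irreflexive star_adj.
Proof. by move=> u; rewrite /star_adj /= eqxx. Qed.

Definition star : sgraph := SGraph star_adj_sym star_adj_irrefl.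
End Star.

(* A cycle of length l is a duplicate-free closed adj-walk with l vertices;
   the bound 2 < l rules out single vertices and back-and-forth edges. *)
Definition cycle_length_at (G : sgraph) (u : G) (l : nat) : bool :=
  (2 < l) && [exists c : l.-tuple G, ucycleb adj c && (u \in c)].

Definition Lset (G : sgraph) (u : G) : pred nat :=
  let u' : star G := u in
  match deg u' with
  | 0 => pred1 0
  | 1 => pred2 0 1
  | _ => cycle_length_at u'
  end.

Definition compatible (n : nat) (G : sgraph) : bool :=
  (3 <= n) && (odd n && [exists u : G, n \notin Lset u]
            || ~~ odd n && [exists u : G, n./2 \notin Lset u]).

(* Main.v *)
Require Import Defs.
From mathcomp Require Import all_boot all_fingroup.
From mathcomp Require Import ssralg zmodp ring.
Set Implicit Arguments.
Unset Strict Implicit.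
Unset Printing Implicit Defensive.
Import GRing.Theory.
(* direct_product also names a construction on finite groups. *)
Import Defs.

(** Put n = 2k+1. Two vertices of a graph are adjacent in its star when they
    have the same degree d and exactly d/2 common neighbours, so every
    automorphism of a graph is one of its star. In G x C_n degrees and numbers
    of common neighbours multiply. As n is odd, i and j in C_n have 2 common
    neighbours if i = j, one if they differ by 2, and none otherwise; as G
    is R-thin, deg u = deg v = #|N(u) :&: N(v)| forces u = v. Hence the star of
    G x C_n is the Cartesian product of the star of G and of the n-cycle
    i -- i+2 (star_productE).

    Let phi be an automorphism of G x C_n. Along a fibre {u} x C_n the vertex
    (u, i+2) is the only common star-neighbour of (u, i) and (u, i+4)
    (fibre_middle), whereas a horizontal and a vertical edge of a Cartesian
    product that share a vertex lie on a 4-cycle. So the image of a fibre never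
    turns a corner (level_step): either it is a fibre again, or it lies in some
    layer G x {j} and is an n-cycle of the star of G, in which case n is in
    L(v) for each vertex v on it (Lset_of_level).

    By compatibility there is a vertex v with n not in L(v); the fibre whose
    image passes through (v, 0) is then mapped onto a fibre, by a formula
    phi (u, i) = (v, a + s * i) with s = 1 or s = -1. For w adjacent to u in G,
    phi (w, i) is adjacent to the images of (u, i-1) and (u, i+1), which leaves
    a + s * i as its only possible second coordinate; this is not constant in
    i, so the fibre of w is mapped onto a fibre too, with the same a and s
    (straight_nbr). Since G is connected, phi acts coordinatewise. *)

(** * Automorphisms preserve the star; direct products *)

Lemma aut_adj (G : sgraph) (s : {perm G}) (u v : G) :
  s \in graph_aut G -> adj (s u) (s v) = adj u v.
Proof. by rewrite inE => /'forall_'forall_eqP. Qed.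

Lemma nbhd_aut (G : sgraph) (s : {perm G}) (u : G) :
  s \in graph_aut G -> nbhd (s u) = s @: nbhd u.
Proof.
move=> sA; apply/setP=> v; rewrite -[v](permKV s) (mem_imset _ _ perm_inj).
by rewrite !inE aut_adj.
Qed.

Lemma star_aut (G : sgraph) (s : {perm G}) (u v : G) :
  s \in graph_aut G -> star_adj (s u) (s v) = star_adj u v.
Proof.
move=> sA; rewrite /star_adj /= (inj_eq perm_inj) /deg !nbhd_aut //.
by rewrite -imsetI ?card_imset //; [exact: perm_inj | exact: perm_inj |
  exact: perm_inj | move=> x y _ _; exact: perm_inj].
Qed.

Lemma star_adjE (G : sgraph) (u v : G) : star_adj u v =
  [&& u != v, deg u == deg v & deg v == 2 * #|nbhd u :&: nbhd v|].
Proof. by []. Qed.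

Lemma nbhd_prod (G H : sgraph) (u : G) (i : H) :
  nbhd ((u, i) : direct_product G H) = setX (nbhd u) (nbhd i).
Proof. by apply/setP=> -[v j]; rewrite !inE. Qed.

Lemma deg_prod (G H : sgraph) (u : G) (i : H) :
  deg ((u, i) : direct_product G H) = deg u * deg i.
Proof. by rewrite /deg nbhd_prod cardsX. Qed.

Lemma card_common_nbhd_prod (G H : sgraph) (u v : G) (i j : H) :
  #|nbhd ((u, i) : direct_product G H) :&: nbhd ((v, j) : direct_product G H)|
  = #|nbhd u :&: nbhd v| * #|nbhd i :&: nbhd j|.
Proof.
rewrite -cardsX !nbhd_prod; apply: eq_card => -[w l].
by rewrite !inE /=; do ![case: (adj _ _)].
Qed.

Lemma deg_gt0 (G : sgraph) (u : G) : 1 < #|G| -> connected G -> 0 < deg u.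
Proof.
move=> /card_gt1P[x [y [_ _ nexy]]] Gconn.
have [v neuv] : exists v, u != v.
  by have [eux|neux] := eqVneq u x; [exists y; rewrite eux | exists x].
have /connectP[[|w p] /=] := Gconn u v.
  by move=> _ evu; rewrite evu eqxx in neuv.
by case/andP=> uw _ _; apply/card_gt0P; exists w; rewrite inE.
Qed.

Section ProductAutomorphisms.
Variables G H : sgraph.

Definition prod_aut_fun (st : {perm G} * {perm H}) (x : direct_product G H) :
  direct_product G H := (st.1 x.1, st.2 x.2).

Lemma prod_aut_fun_inj st : injective (prod_aut_fun st).
Proof. by move=> [u i] [v j] [/perm_inj-> /perm_inj->]. Qed.

Definition prod_aut st : {perm direct_product G H} :=
  perm (@prod_aut_fun_inj st).

Lemma prod_autM :
  {in setX (graph_aut G) (graph_aut H) &,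
    {morph prod_aut : x y / (x * y)%g}}.
Proof.
move=> x y _ _; apply/permP=> z.
by rewrite permM !permE /prod_aut_fun /= !permM.
Qed.

(** The coordinatewise action always embeds the product of the automorphism
    groups as soon as both graphs have a vertex, so only surjectivity is at
    stake; the vertices u0 and i0 make the action faithful. *)
Lemma stable_of_split (u0 : G) (i0 : H) :
  (forall phi, phi \in graph_aut (direct_product G H) ->
    exists2 st, st \in setX (graph_aut G) (graph_aut H) & phi = prod_aut st) ->
  stable G H.
Proof.
move=> split; apply/isogP; exists (Morphism prod_autM).
  apply/injmP=> -[s t] [s' t'] _ _ /= /permP eq_st; congr pair.
    by apply/permP=> u; have := eq_st (u, i0); rewrite !permE => -[].
  by apply/permP=> i; have := eq_st (u0, i); rewrite !permE => -[].
apply/setP=> phi; rewrite morphimEdom.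
apply/imsetP/idP => [[[s t]]|/split[st]]; last by exists st.
rewrite inE /= => /andP[sA tA ->]; rewrite inE.
apply/'forall_'forall_eqP=> -[u i] [v j].
rewrite !permE -[LHS]/(adj (s u) (s v) && adj (t i) (t j)).
by rewrite !aut_adj.
Qed.
End ProductAutomorphisms.

(** * Odd cycles as rings of residues *)

Section OddCycle.
Variable m : nat.
Hypothesis n_odd : odd m.+3.
Local Notation Z := 'I_m.+3.
Local Open Scope ring_scope.

Lemma eq_addr_self (i j : Z) : (i == i + j) = (j == 0).
Proof. by rewrite -subr_eq0 opprD addrA subrr sub0r oppr_eq0. Qed.

Lemma cycle_adjE (i j : Z) : cycle_adj i j = (j == i + 1) || (i == j + 1).
Proof.
have ordSE (l : Z) : ordS l = l + 1 by apply: val_inj; rewrite /= addn1.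
rewrite /cycle_adj /= !ordSE [i + 1 == j]eq_sym [j + 1 == i]eq_sym.
have [->|//] := eqVneq i j.
by rewrite orbb eq_addr_self.
Qed.

Lemma natr_cycle_order : m.+3%:R = 0 :> Z.
Proof. by apply: val_inj; rewrite Zp_nat /= modnn. Qed.

(** Oddness of the order n enters only here: (n+1)/2 is an inverse of 2 modulo
    n. It makes 2, 4 and 8 nonzero and lets steps of length 2 reach every
    residue. *)
Lemma half_cycle : 2 * (m.+4)./2%:R = 1 :> Z.
Proof.
rewrite -natrM mul2n even_halfK; last by rewrite oddS n_odd.
by rewrite -natr1 natr_cycle_order add0r.
Qed.

Lemma mul2_eq0 (x : Z) : (2 * x == 0) = (x == 0).
Proof.
apply/eqP/eqP=> [x2|->]; last exact: mulr0.
by rewrite -[x]mul1r -half_cycle mulrAC x2 mul0r.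
Qed.

Lemma two_neq0 : 2 != 0 :> Z.
Proof. by rewrite -[2]mulr1 mul2_eq0. Qed.

Lemma four_neq0 : 4 != 0 :> Z.
Proof. by rewrite (_ : 4 = 2 * 2) ?mul2_eq0 ?two_neq0 //; ring. Qed.

Lemma eight_neq0 : 8 != 0 :> Z.
Proof. by rewrite (_ : 8 = 2 * 4) ?mul2_eq0 ?four_neq0 //; ring. Qed.

Lemma common_cycle_nbrP (i c : Z) :
  cycle_adj (i - 1) c -> cycle_adj (i + 1) c -> c = i.
Proof.
rewrite !cycle_adjE => /orP[/eqP->|/eqP e1]; first by move=> _; ring.
case/orP=> /eqP e2; last by apply: (addIr 1); rewrite -e2.
case/eqP: four_neq0.
rewrite (_ : 4 = i + 1 + 1 + 1 - (i - 1)); last by ring.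
by rewrite -e2 -e1 subrr.
Qed.

Lemma cycle_nbhdE (i : Z) :
  nbhd (i : cycle_graph m.+3) = [set i - 1; i + 1].
Proof.
apply/setP=> j; rewrite !inE; rewrite -[LHS]/(cycle_adj i j) cycle_adjE orbC.
by rewrite -subr_eq [j == i - 1]eq_sym.
Qed.

Lemma deg_cycle (i : Z) : deg (i : cycle_graph m.+3) = 2%N.
Proof.
rewrite /deg cycle_nbhdE cards2; case: eqP => // e; case/eqP: two_neq0.
rewrite (_ : 2 = i + 1 - (i - 1)); last by ring.
by rewrite e subrr.
Qed.

Lemma card_common_cycle_nbhd (i j : Z) : i != j ->
  #|nbhd (i : cycle_graph m.+3) :&: nbhd (j : cycle_graph m.+3)|
  = ((j == i + 2) || (i == j + 2)).
Proof.
move=> neij.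
have card_step (l : Z) :
    #|nbhd (l : cycle_graph m.+3) :&: nbhd (l + 2 : cycle_graph m.+3)| = 1%N.
  apply/eqP/cards1P; exists (l + 1); apply/setP=> x; rewrite !cycle_nbhdE !inE.
  rewrite (_ : l + 2 - 1 = l + 1); last by ring.
  have [->|nex] := eqVneq x (l + 1); first by rewrite orbT.
  rewrite orbF; apply/andP=> -[/eqP-> /eqP e]; case/eqP: four_neq0.
  rewrite (_ : 4 = l + 2 + 1 - (l - 1)); last by ring.
  by rewrite -e subrr.
have [->|neji] /= := eqVneq j (i + 2); first exact: card_step.
have [->|neij2] /= := eqVneq i (j + 2); first by rewrite setIC card_step.
apply/eqP; rewrite cards_eq0; apply/eqP/setP=> x; rewrite !cycle_nbhdE !inE.
apply/andP=> -[/orP[]/eqP-> /orP[]];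
  rewrite ?(inj_eq (addIr _)) ?(negPf neij) //.
  rewrite subr_eq => /eqP e; case/eqP: neij2; rewrite e; ring.
rewrite -[_ == j - 1]subr_eq0 => /eqP e; case/eqP: neji.
apply/eqP; rewrite eq_sym -subr_eq0 -e; apply/eqP; ring.
Qed.

(** The steps i -> i + 2 go around the whole cycle because 2 is invertible: i
    is reached from c after (i - c)/2 of them. *)
Lemma cycle_gen (P : Z -> Prop) (c : Z) :
  P c -> (forall i, P i -> P (i + 2)) -> forall i, P i.
Proof.
move=> P0 PS i.
have P_even k : P (c + 2 * k%:R).
  elim: k => [|k IHk]; first by rewrite mulr0 addr0.
  by rewrite -[k.+1%:R]natr1 mulrDr mulr1 addrA; apply: PS.
have := P_even ((m.+4)./2 * (i - c : Z)%R)%N.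
rewrite natrM mulrA half_cycle mul1r natr_Zp.
rewrite (_ : c + (i - c) = i) //; ring.
Qed.

Lemma shift2_const (T : Type) (g : Z -> T) :
  (forall i, g (i + 2) = g i) -> forall i, g i = g 0.
Proof.
by move=> g2; apply: (cycle_gen (P := fun i => g i = g 0)) => // i <-.
Qed.

(** These are the injective endomorphisms of the n-cycle i -- i+2: such a
    map cannot turn back, so all its steps have the sign s of the first one. *)
Lemma two_step_affine (f : Z -> Z) : injective f ->
  (forall i, (f (i + 2) == f i + 2) || (f i == f (i + 2) + 2)) ->
  exists2 s : Z, s = 1 \/ s = -1 & forall i, f i = f 0 + s * i.
Proof.
move=> f_inj f_step.
have [s s_sign f2] : exists2 s : Z, s = 1 \/ s = -1 & f 2 = f 0 + s * 2.
  have := f_step 0; rewrite add0r => /orP[]/eqP e.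
    by exists 1; [left | rewrite mul1r].
  by exists (-1); [right | rewrite e; ring].
exists s => // i.
(* The direction of the current step is carried along the induction. *)
suff [] : f i = f 0 + s * i /\ f (i + 2) = f i + s * 2 by [].
move: i; apply: (@cycle_gen _ 0) => [|i [fi fi2]].
  by rewrite mulr0 addr0 add0r.
split; first by rewrite fi2 fi; ring.
have ne: f (i + 2 + 2) != f i.
  rewrite (inj_eq f_inj); apply/eqP=> e; case/eqP: four_neq0.
  rewrite (_ : 4 = i + 2 + 2 - i); last by ring.
  by rewrite e subrr.
case/orP: (f_step (i + 2)) => /eqP e; case: s_sign => es.
- by rewrite e es mul1r.
- by case/eqP: ne; rewrite e fi2 es; ring.
- case/eqP: ne; apply: (addIr 2); rewrite -e fi2 es; ring.
- by rewrite es e; ring.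
Qed.

(** An n-cycle of the star gives each of its vertices two distinct neighbours,
    so Lset is there the set of cycle lengths, not one of its two special
    values. *)
Lemma star_cycle_mem_Lset (G : sgraph) (q : Z -> G) : injective q ->
  (forall i, star_adj (q i) (q (i + 1))) -> forall i, m.+3 \in Lset (q i).
Proof.
move=> q_inj q_step i.
have deg_qi : (1 < deg (q i : star G))%N.
  apply/card_gt1P; exists (q (i - 1)), (q (i + 1)); rewrite !inE; split.
  - rewrite -[adj _ _]/(star_adj _ _) star_adj_sym.
    by have := q_step (i - 1); rewrite subrK.
  - exact: q_step.
  rewrite (inj_eq q_inj); apply/eqP=> e; case/eqP: two_neq0.
  rewrite (_ : 2 = i + 1 - (i - 1)); last by ring.
  by rewrite e subrr.
have -> : m.+3 \in Lset (q i) = cycle_length_at (q i : star G) m.+3.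
  rewrite unfold_in /Lset /=; move: deg_qi; rewrite /deg /=.
  by case: #|_| => [|[]].
apply/existsP.
pose s := [seq q j%:R | j <- iota 0 m.+3].
have sz : size s == m.+3 by rewrite size_map size_iota.
have cast (j : Z) : (j : nat)%:R = j by exact: natr_Zp.
exists (Tuple sz); rewrite /= -/s; apply/andP; split; last first.
  apply/mapP; exists (i : nat); first by rewrite mem_iota add0n ltn_ord.
  by rewrite cast.
apply/andP; split; last first.
  rewrite map_inj_in_uniq ?iota_uniq // => j l.
  rewrite !mem_iota !add0n /= => jm lm /q_inj/(congr1 val).
  by rewrite !Zp_nat /= !modn_small.
have path_q k a : path (@star_adj G) (q a%:R) [seq q j%:R | j <- iota a.+1 k].
  elim: k a => //= k IHk a; rewrite IHk andbT -[a.+1%:R]natr1; exact: q_step.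
suff : path (@star_adj G) (q 0%:R)
    (rcons [seq q j%:R | j <- iota 1 m.+2] (q m.+3%:R)).
  by rewrite natr_cycle_order.
have := path_q m.+3 0%N.
have -> : iota 1 m.+3 = rcons (iota 1 m.+2) m.+3.
  by rewrite -[m.+3 in LHS]addn1 iotaD cats1 add1n.
by rewrite map_rcons.
Qed.
End OddCycle.

(** * The star of the product with an odd cycle *)

Section Product.
Variables (G : sgraph) (m : nat).
Hypotheses (Gnontrivial : 1 < #|G|) (Gthin : rthin G) (Gconn : connected G).
Hypothesis n_odd : odd m.+3.
Local Notation Z := 'I_m.+3.
Local Notation P := (direct_product G (cycle_graph m.+3)).
Local Open Scope ring_scope.

Definition cycle_step (i j : Z) := (j == i + 2) || (i == j + 2).

Lemma cycle_step_irrefl i : cycle_step i i = false.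
Proof.
by rewrite /cycle_step orbb eq_addr_self (negPf (two_neq0 n_odd)).
Qed.

Lemma cycle_step_neq i j : cycle_step i j -> (i == j) = false.
Proof. by apply: contraTF => /eqP->; rewrite cycle_step_irrefl. Qed.

(** For u = v and i = j + 2 or j - 2 the equation between degree and number of
    common neighbours reads 2 * deg u = 2 * deg u, while for u != v it makes
    u and v have the same neighbourhood; degrees are positive as G is connected
    with at least two vertices. *)
Lemma star_productE (u v : G) (i j : Z) :
  star_adj ((u, i) : P) ((v, j) : P)
  = (i == j) && star_adj u v || (u == v) && cycle_step i j.
Proof.
rewrite !star_adjE xpair_eqE !deg_prod !deg_cycle // card_common_nbhd_prod.
rewrite eqn_pmul2r //.
have [<-|neij] := eqVneq i j.
  rewrite setIid -/(deg _) deg_cycle // cycle_step_irrefl andbF orbF andbT.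
  by rewrite mulnA eqn_pmul2r.
rewrite andbF card_common_cycle_nbhd // -/(cycle_step i j) /=.
have [<-|neuv] := eqVneq u v.
  rewrite eqxx setIid -/(deg u) /=; case: cycle_step.
    by rewrite muln1 mulnC eqxx.
  by rewrite !muln0 muln_eq0 orbF eqn0Ngt deg_gt0.
rewrite /=; apply/andP=> -[/eqP euv]; case: cycle_step; last first.
  by rewrite !muln0 muln_eq0 orbF eqn0Ngt deg_gt0.
rewrite muln1 mulnC eqn_pmul2l // => /eqP e.
have/eqP NuI : nbhd u :&: nbhd v == nbhd u.
  by rewrite eqEcard subsetIl -e -euv leqnn.
have/eqP NvI : nbhd u :&: nbhd v == nbhd v.
  by rewrite eqEcard subsetIr -e leqnn.
by have := Gthin neuv; rewrite -{1}NuI NvI eqxx.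
Qed.

(** A neighbour of (u, i) outside the fibre of u lies in the layer of (u, i),
    so it shares no coordinate with (u, i + 4). Inside the fibre, the other
    neighbour (u, i - 2) is adjacent to (u, i + 4) only if 4 = 0 or 8 = 0. *)
Lemma fibre_middle (u : G) (i : Z) (y : P) :
  star_adj ((u, i) : P) y -> star_adj y ((u, i + 4) : P) -> y = (u, i + 2).
Proof.
case: y => w j; rewrite !star_productE.
have i4 : i != i + 4.
  by rewrite eq_addr_self four_neq0.
case/orP=> [/andP[/eqP<- uw]|/andP[/eqP<-]].
  rewrite (negPf i4) /=; case/andP=> /eqP ewu.
  by rewrite ewu star_adj_irrefl in uw.
rewrite star_adj_irrefl andbF eqxx /= /cycle_step.
case/orP=> /eqP e1; first by rewrite e1.
rewrite e1 in i4 *; case/orP=> /eqP e2.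
  case/eqP: (four_neq0 n_odd).
  rewrite (_ : 4 = j + 2 + 4 - (j + 2)); last by ring.
  by rewrite e2 subrr.
case/eqP: (eight_neq0 n_odd); rewrite (_ : 8 = j + 2 + 4 + 2 - j); last by ring.
by rewrite {2}e2 subrr.
Qed.

(** * Images of fibres *)

Section Aut.
Variable phi : {perm P}.
Hypothesis phiA : phi \in graph_aut P.

Lemma fibre_step u i : star_adj (phi (u, i)) (phi (u, i + 2)).
Proof. by rewrite star_aut // star_productE eqxx /cycle_step eqxx orbT. Qed.

Lemma fibre_no_corner u i (w : G) (j : Z) :
  star_adj (phi (u, i)) ((w, j) : P) ->
  star_adj ((w, j) : P) (phi (u, i + 4)) ->
  (w, j) = phi (u, i + 2).
Proof.
rewrite -[(w, j)](permKV phi) !star_aut // => a b; congr (phi _).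
exact: fibre_middle.
Qed.

(** Both vertices are joined by a star edge (fibre_step), so having equal second
    coordinates means that this edge is horizontal. *)
Definition level u i := (phi (u, i)).2 == (phi (u, i + 2)).2.

(** If two consecutive edges had images of different kinds, the fourth vertex
    of the square that these images span would be a second common neighbour of
    their ends, against fibre_no_corner. *)
Lemma level_step u i : level u i = level u (i + 2).
Proof.
rewrite /level (_ : i + 2 + 2 = i + 4); last by ring.
have := fibre_step u i; have := fibre_step u (i + 2).
rewrite (_ : i + 2 + 2 = i + 4); last by ring.
have := @fibre_no_corner u i.
case: (phi (u, i)) (phi (u, i + 2)) (phi (u, i + 4)) => [v j] [w l] [x r] /=.
move=> corner; rewrite !star_productE /=.
case/orP=> /andP[/eqP e1 e2] /orP[]/andP[/eqP e3 e4]; subst.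
- by rewrite eqxx.
- have := corner x j; rewrite !star_productE !eqxx e2 e4 !orbT.
  move=> /(_ isT isT)[].
  by move=> exw; rewrite exw star_adj_irrefl in e2.
- have := corner v r; rewrite !star_productE !eqxx e2 e4 !orbT.
  move=> /(_ isT isT)[].
  by move=> exw; rewrite exw star_adj_irrefl in e4.
- by rewrite (cycle_step_neq e2) (cycle_step_neq e4).
Qed.

Lemma level_const u (i : Z) : level u i = level u 0.
Proof.
by apply: (shift2_const n_odd (g := level u)) => l; rewrite -level_step.
Qed.

(** The first coordinates along a horizontal image form an n-cycle of the star
    of G; reading the fibre in the order 0, 2, 4, ... makes consecutive terms
    adjacent. *)
Lemma Lset_of_level u : level u 0 -> forall i, m.+3 \in Lset (phi (u, i)).1.
Proof.
move=> lev.
have snd_const (i : Z) : (phi (u, i)).2 = (phi (u, 0)).2.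
  apply: (shift2_const n_odd (g := fun i => (phi (u, i)).2)) => {}i.
  by apply/esym/eqP; rewrite -/(level u i) level_const.
pose q (i : Z) := (phi (u, 2 * i)).1.
have q_inj : injective q.
  move=> i j eij.
  have: phi (u, 2 * i) = phi (u, 2 * j).
    by apply: injective_projections => //; rewrite !snd_const.
  move/perm_inj/(congr1 snd) => /= e; apply/eqP.
  by rewrite -subr_eq0 -(mul2_eq0 n_odd) mulrBr e subrr.
have q_step i : star_adj (q i) (q (i + 1)).
  rewrite /q (_ : 2 * (i + 1) = 2 * i + 2); last by ring.
  have := fibre_step u (2 * i); have := level_const u (2 * i).
  rewrite lev /level.
  case: (phi _) (phi _) => [v j] [w l] /= /eqP <-.
  by rewrite star_productE cycle_step_irrefl andbF orbF eqxx.
move=> i; have := star_cycle_mem_Lset n_odd q_inj q_step ((m.+4)./2%:R * i).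
by rewrite /q mulrA half_cycle // mul1r.
Qed.

Definition straight u (a s : Z) :=
  exists v, forall i, phi (u, i) = (v, a + s * i).

Lemma fibre_cycle_step u (i : Z) : ~~ level u 0 ->
  (phi (u, i)).1 = (phi (u, i + 2)).1 /\
  cycle_step (phi (u, i)).2 (phi (u, i + 2)).2.
Proof.
move: (fibre_step u i); rewrite -(level_const u i) /level.
case: (phi _) (phi _) => [v j] [w l] /=.
by rewrite star_productE => /orP[/andP[->]|/andP[/eqP]].
Qed.

Lemma fibre_fst_const u : ~~ level u 0 ->
  exists v, forall i : Z, (phi (u, i)).1 = v.
Proof.
move=> nlev; exists (phi (u, 0)).1 => i.
apply: (shift2_const n_odd (g := fun i => (phi (u, i)).1)) => {}i.
by case: (fibre_cycle_step i nlev).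
Qed.

Lemma straight_of_not_level u : ~~ level u 0 ->
  exists a s, (s = 1 \/ s = -1) /\ straight u a s.
Proof.
move=> nlev; have [v fst_u] := fibre_fst_const nlev.
have snd_inj : injective (fun i : Z => (phi (u, i)).2).
  move=> i j eij; have/perm_inj/(congr1 snd) // : phi (u, i) = phi (u, j).
  by apply: injective_projections; rewrite // !fst_u.
have [|s s_sign aff] := two_step_affine n_odd snd_inj.
  by move=> i; case: (fibre_cycle_step i nlev).
exists (phi (u, 0)).2, s; split=> //; exists v => i.
by apply: injective_projections; [exact: fst_u | exact: aff].
Qed.

Lemma cycle_adj_affine (a s i j : Z) : s = 1 \/ s = -1 ->
  cycle_adj (a + s * i) (a + s * j) = cycle_adj i j.
Proof.
rewrite !cycle_adjE => -[] ->; last rewrite orbC; congr orb;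
  rewrite -subr_eq0 -[RHS]subr_eq0; congr (_ == 0); ring.
Qed.

(** The images of (u, i - 1) and (u, i + 1) pin down the second coordinate of
    the image of (w, i). It varies with i, so the fibre of w is not sent into
    a layer and its first coordinate is constant. *)
Lemma straight_nbr u w a s : s = 1 \/ s = -1 ->
  adj u w -> straight u a s -> straight w a s.
Proof.
move=> s_sign uw [v phi_u].
have snd_w (i : Z) : (phi (w, i)).2 = a + s * i.
  have nbr (j : Z) : cycle_adj j i -> cycle_adj (a + s * j) (phi (w, i)).2.
    move=> ji; have: adj (phi (u, j)) (phi (w, i)).
      by rewrite aut_adj //; apply/andP.
    by rewrite phi_u => /andP[].
  have nbr_pred : cycle_adj (i - 1) i by rewrite cycle_adjE subrK eqxx.
  have nbr_succ : cycle_adj (i + 1) i by rewrite cycle_adjE eqxx orbT.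
  have := nbr _ nbr_succ; have := nbr _ nbr_pred.
  case: s_sign => -> n1 n2; apply: (common_cycle_nbrP n_odd).
  - by rewrite (_ : _ - 1 = a + 1 * (i - 1)); last ring.
  - by rewrite (_ : _ + 1 = a + 1 * (i + 1)); last ring.
  - by rewrite (_ : _ - 1 = a + -1 * (i + 1)); last ring.
  - by rewrite (_ : _ + 1 = a + -1 * (i - 1)); last ring.
have [|v' phi_w] := @fibre_fst_const w.
  rewrite /level !snd_w (inj_eq (addrI a)) mulrDr eq_addr_self.
  by case: s_sign => ->; rewrite ?mul1r // mulN1r oppr_eq0 two_neq0.
by exists v' => i; apply: injective_projections; rewrite ?phi_w ?snd_w.
Qed.

Lemma straight_all u a s : s = 1 \/ s = -1 ->
  straight u a s -> forall w, straight w a s.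
Proof.
move=> s_sign str w; have /connectP[p] := Gconn u w.
elim: p u str => [|x p IHp] u str /=; first by move=> _ ->.
by case/andP=> ux; apply: IHp; apply: straight_nbr ux str.
Qed.

(** Adjacency of sigma u and sigma w is read off the pairs (u, 0) and (w, 1),
    since 0 and 1 are adjacent in the cycle. *)
Lemma aut_of_straight (a s : Z) : s = 1 \/ s = -1 ->
  (forall u, straight u a s) ->
  exists2 st, st \in setX (graph_aut G) (graph_aut (cycle_graph m.+3)) &
    phi = prod_aut st.
Proof.
move=> s_sign str; pose sigma u := (phi (u, 0)).1.
pose tau (i : cycle_graph m.+3) : cycle_graph m.+3 := a + s * i.
have phiE u (i : Z) : phi (u, i) = (sigma u, tau i).
  by rewrite /sigma; case: (str u) => v e; rewrite !e.
have sigma_inj : injective sigma.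
  move=> u w e; suff [] : (u, 0) = (w, 0) :> P by [].
  by apply: (perm_inj (s := phi)); rewrite !phiE e.
have tau_inj : injective tau.
  move=> i j /addrI; case: s_sign => ->; first by rewrite !mul1r.
  by rewrite !mulN1r => /oppr_inj.
exists (perm sigma_inj, perm tau_inj); last first.
  by apply/permP=> -[u i]; rewrite phiE permE /prod_aut_fun /= !permE.
rewrite !inE /=; apply/andP; split; apply/'forall_'forall_eqP.
  move=> u w; rewrite !permE.
  have := aut_adj ((u, 0) : P) ((w, 1) : P) phiA; rewrite !phiE.
  rewrite -[LHS]/(adj (sigma u) (sigma w) && cycle_adj (tau 0) (tau 1)).
  rewrite -[RHS]/(adj u w && cycle_adj (0 : Z) (1 : Z)) /tau.
  rewrite cycle_adj_affine //.
  by rewrite cycle_adjE add0r eqxx !andbT.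
by move=> i j; rewrite !permE; apply: cycle_adj_affine.
Qed.

End Aut.

Lemma product_aut_split (v : G) : m.+3 \notin Lset v ->
  forall phi, phi \in graph_aut P ->
  exists2 st, st \in setX (graph_aut G) (graph_aut (cycle_graph m.+3)) &
    phi = prod_aut st.
Proof.
move=> nLv phi phiA.
have [[u i] phi_ui] : exists x, phi x = (v, 0) :> P.
  by exists ((phi^-1)%g (v, 0)); rewrite permKV.
have [|a [s [s_sign str]]] := straight_of_not_level phiA (u := u).
  by apply: contra nLv => /(Lset_of_level phiA)/(_ i); rewrite phi_ui.
by apply: (aut_of_straight phiA s_sign) => w; apply: straight_all str w.
Qed.
End Product.

(* The hypothesis 1 < #|G| excludes the one-vertex graph K_1, which has no
   edge: Aut (K_1 x C_n) is then the full symmetric group on n points, so the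
   claim fails for it whenever n >= 4. *)
Theorem theorem1p4 (G : sgraph) (k : nat) (Gnontrivial : 1 < #|G|)
    (Gthin : rthin G) (Gconn : connected G) (k_ge1 : 1 <= k)
    (Gcompat : compatible (2 * k + 1) G) :
  stable G (cycle_graph (2 * k + 1)).
Proof.
case: k k_ge1 Gcompat => // k _.
have -> : 2 * k.+1 + 1 = (2 * k).+3 by rewrite mulnS addn1.
have n_odd : odd (2 * k).+3 by rewrite /= oddM.
rewrite /compatible n_odd orbF => /andP[_ /existsP[v nLv]].
apply: (stable_of_split v (ord0 : cycle_graph _)) => phi.
exact: product_aut_split nLv phi.
Qed.
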